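(* Let $\kappa$ be an infinite cardinal such that $\kappa^{<\kappa}=\kappa$, and let $\mathcal{L}\subseteq\mathrm{Lin}_\kappa$ be nonempty and downward $\preceq$-closed. Then the following are equivalent: (i) $\mathcal{L}$ is ccs; (ii) $\trianglelefteq^{\mathcal{L}}$ is transitive (as a relation on all linear orders); (iii) the restriction of $\trianglelefteq^{\mathcal{L}}$ to $\mathrm{Lin}_\kappa$ is transitive; (iv) $\trianglelefteq^{\mathcal{L}}_\kappa$ is transitive.
   Context: Linear orders are reflexive and nonempty; $L\preceq L'$ means there is an embedding $f:L\to L'$, i.e. $x\le_L y\iff f(x)\le_{L'}f(y)$. For a cardinal $\kappa$, $\mathrm{LO}_\kappa$ is the set of (codes for) linear orders with domain $\kappa$, and $\mathrm{Lin}_\kappa=\bigcup_{0<\lambda\le\kappa}\mathrm{LO}_\lambda$ ($\lambda$ ranging over cardinals), i.e. the nonempty linear orders of size at most $\kappa$. $\mathcal{L}\subseteq\mathrm{Lin}_\kappa$ is downward $\preceq$-closed if $K\in\mathrm{Lin}_\kappa$, $K\preceq L\in\mathcal{L}$ imply $K\in\mathcal{L}$; membership is meant up to isomorphism. A subset $I$ of $L$ is convex if $x\le_L y\le_L z$ and $x,z\in I$ imply $y\in I$. For $A,B\subseteq L$ write $A\le_L B$ (resp. $A<_L B$) if $a\le_L b$ (resp. $a<_L b$) for all $a\in A$, $b\in B$. A $K$-convex partition of $L$ is a partition $(L_k)_{k\in K}$ of $L$ (into nonempty sets) such that $k<_K k'\iff L_k<_L L_{k'}$. $L\trianglelefteq^{\mathcal{L}}L'$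 iff there are $K\in\mathcal{L}$, a $K$-convex partition $(L_k)_{k\in K}$ of $L$, and an embedding $f$ of $L$ into $L'$ such that each $f(L_k)$ is a convex subset of $L'$. $\trianglelefteq^{\mathcal{L}}_\kappa$ is the restriction of $\trianglelefteq^{\mathcal{L}}$ to $\mathrm{LO}_\kappa$. $\mathcal{L}$ is ccs (closed under convex sums) if for all $K,K'\in\mathcal{L}$ and every family $(K'_k)_{k\in K}$ of nonempty convex subsets of $K'$ such that $k_0<_K k_1\Rightarrow K'_{k_0}\le_{K'}K'_{k_1}$ for all $k_0,k_1\in K$, we have $\sum_{k\in K}K'_k\in\mathcal{L}$, where $\sum_{k\in K}K'_k=\{(x,k): k\in K, x\in K'_k\}$ ordered antilexicographically. *)

(* Defs.v *)
From Corelib Require Export RelationClasses.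
From mathcomp Require Export all_boot.
From mathcomp Require Export boolp classical_sets functions cardinality wochoice.

Set Implicit Arguments.
Unset Strict Implicit.
Unset Printing Implicit Defensive.

Local Open Scope classical_set_scope.
Local Open Scope card_scope.

(* Cardinals are initial ordinals: well-orders in which every proper initial
   segment has strictly smaller cardinality than the whole. *)
Definition initseg (T : Type) (r : rel T) (a : T) : set T :=
  [set b | r b a /\ b <> a].

Record cardinal := Cardinal {
  card_sort :> Type;
  ord_le : rel card_sort;
  ord_le_wo : well_order ord_le;
  card_initial : forall a, ~~ ([set: card_sort] #<= initseg ord_le a) }.

Definition infinite_cardinal (kappa : cardinal) : Prop :=
  infinite_set [set: kappa].

(* The set of sequences in kappa of length < kappa; the length is the ordinal
   represented by the initial segment below [a]. *)
Definition lt_sequences (kappa : cardinal) : Type :=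
  {a : kappa & {b : kappa | initseg (@ord_le kappa) a b} -> kappa}.

Definition pow_lt_self (kappa : cardinal) : Prop :=
  [set: lt_sequences kappa] #= [set: kappa].

(* The (codes for) linear orders with domain T; linear orders are nonempty. *)
Record LO (T : Type) := MkLO {
  le_code : rel T;
  le_code_total_order : total_order le_code;
  le_code_inhabited : inhabited T }.

Record linOrd := LinOrd {
  lin_sort :> Type;
  lin_LO : LO lin_sort }.

Definition lin_of (T : Type) (r : LO T) : linOrd := LinOrd r.

Definition lin_le (L : linOrd) : rel L := le_code (lin_LO L).
Definition lin_lt (L : linOrd) (x y : L) : Prop := lin_le x y /\ x <> y.

(* Classes of linear orders are plain predicates, as [set linOrd] would bound the
   universe of the carriers by that of [set]. *)
Definition Lin (kappa : cardinal) (L : linOrd) : Prop :=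
  [set: L] #<= [set: kappa].

Definition embedding (L L' : linOrd) (f : L -> L') : Prop :=
  forall x y, lin_le x y = lin_le (f x) (f y).

Definition embeds (L L' : linOrd) : Prop := exists f : L -> L', embedding f.

Definition convex (L : linOrd) (I : set L) : Prop :=
  forall x y z, lin_le x y -> lin_le y z -> I x -> I z -> I y.

Definition set_le (L : linOrd) (A B : set L) : Prop :=
  forall a b, A a -> B b -> lin_le a b.

Definition set_lt (L : linOrd) (A B : set L) : Prop :=
  forall a b, A a -> B b -> lin_lt a b.

Definition convex_partition (K L : linOrd) (P : K -> set L) : Prop :=
  partition [set: K] P [set: L] /\
  forall k k', lin_lt k k' <-> set_lt (P k) (P k').

Definition cvx_embeds (calL : linOrd -> Prop) (L L' : linOrd) : Prop :=
  exists K : linOrd, calL K /\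
  exists P : K -> set L, convex_partition P /\
  exists f : L -> L', embedding f /\ forall k, convex (f @` P k).

(* Closure under isomorphism is included, since isomorphic orders embed into
   each other. *)
Definition downward_closed (kappa : cardinal) (calL : linOrd -> Prop) : Prop :=
  forall K L, Lin kappa K -> embeds K L -> calL L -> calL K.

Section ConvexSum.
Variables (K K' : linOrd) (F : K -> set K').

Definition csum_type := {p : K' * K | F p.2 p.1}.

(* Antilexicographic order: the second components are compared first. *)
Definition csum_le : rel csum_type := fun u v =>
  lin_le (sval u).2 (sval v).2 &&
  (lin_le (sval v).2 (sval u).2 ==> lin_le (sval u).1 (sval v).1).

Lemma csum_total_order : total_order csum_le.
Proof.
case: (le_code_total_order (lin_LO K)) => -[[Kr Kt] Ka] Ktot.
case: (le_code_total_order (lin_LO K')) => -[[K'r K't] K'a] K'tot.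
rewrite -/(@lin_le K) in Kr Kt Ka Ktot; rewrite -/(@lin_le K') in K'r K't K'a K'tot.
split; first split; first split.
- by move=> u; rewrite /csum_le Kr K'r.
- move=> v u w; rewrite /csum_le.
  move=> /andP[uv /implyP uv'] /andP[vw /implyP vw'].
  rewrite (Kt _ _ _ uv vw); apply/implyP => wu.
  by apply: (K't (sval v).1); [apply: uv'; apply: Kt wu | apply: vw'; apply: Kt uv].
- move=> u v; rewrite /csum_le => /andP[/andP[uv /implyP h] /andP[vu /implyP h']].
  apply: eq_sig_hprop => [? ? ?|]; first exact: Prop_irrelevance.
  rewrite [sval u]surjective_pairing [sval v]surjective_pairing.
  by congr pair; [apply: K'a; rewrite h ?h' | apply: Ka; rewrite uv vu].
- move=> u v; rewrite /csum_le.
  case/orP: (Ktot (sval u).2 (sval v).2) => e; rewrite e /=;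
    by case: (lin_le _ _) => //=; rewrite ?orbT.
Qed.

Hypothesis F_neq0 : forall k, F k !=set0.

Lemma csum_inhabited : inhabited csum_type.
Proof.
case: (le_code_inhabited (lin_LO K)) => k; case: (F_neq0 k) => x Fx.
by apply: inhabits; exists (x, k).
Qed.

Definition csum : linOrd := LinOrd (MkLO csum_total_order csum_inhabited).

End ConvexSum.

Definition ccs (calL : linOrd -> Prop) : Prop :=
  forall (K K' : linOrd), calL K -> calL K' ->
  forall (F : K -> set K') (F_neq0 : forall k, F k !=set0),
    (forall k, convex (F k)) ->
    (forall k0 k1, lin_lt k0 k1 -> set_le (F k0) (F k1)) ->
    calL (csum F_neq0).

(* Main.v *)
Require Import Defs.

Set Implicit Arguments.
Unset Strict Implicit.
Unset Printing Implicit Defensive.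

Local Open Scope classical_set_scope.
Local Open Scope card_scope.

(** If [calL] is closed under convex sums, convex embeddings compose: the pieces
    of [f : L -> L'] are cut along the preimages of the pieces of [L' -> L''], and
    the pieces so obtained are indexed by the convex sum over [k] of the convex
    sets of those [k'] whose piece meets the image of [L_k]
    ([cvx_embeds_trans]). The two other transitivity properties are restrictions
    of this one.

    Conversely, let transitivity hold on orders with domain [kappa], and let [C]
    be a convex sum of convex subsets of [K'] along [K], with elements [(k', k)].
    Take [A := omega^* + kappa], in which every point has an immediate successor
    but in which there is no least point. Replace every point of [C] by [A], and
    add in front of a copy of [A] one further point, a gap, at no point of [C] for
    [L], at those [(k', k)] with [k'] the least index over [k] for [L'], and at
    every point of [C] for [L'']. Between two points of [L] over the same [k] there
    is no gap of [L'], and between two points of [L'] over the same [k'] all gaps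
    of [L''] are already in [L']. So the inclusions [L -> L' -> L''] are convex on
    the pieces given by [K] and [K'] respectively. All three orders have size
    [kappa], because [kappa^{<kappa} = kappa] yields [kappa * kappa = kappa], and
    hence there are copies of them with domain [kappa]. By transitivity there is
    an embedding of [L] into [L''] convex on the pieces indexed by some [K2] in
    [calL]. A gap of [L''] has no immediate successor while every point of [L] has
    one, and this prevents a piece from meeting two copies of [A]
    ([blowup_separated]). So [C] embeds into [K2], and [C] is in [calL] by downward
    closure ([trans_ccs]). *)

Lemma card_leTP (T U : Type) :
  [set: T] #<= [set: U] <-> exists f : T -> U, injective f.
Proof.
split=> [/card_leP[f]|[f fi]].
  pose g (x : T) : U := set_val (f (to_setT x)).
  exists g => x y /val_inj e.
  have /(congr1 val)// : to_setT x = to_setT y.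
  by apply: (@inj _ _ _ f) e; rewrite inE.
have := @inj_card_eq T U [set: T] f (in2W fi).
rewrite card_eq_le => /andP[_ /card_le_trans]; apply; exact: card_leT.
Qed.

(** * Linear orders *)

Section LinearOrder.
Variable L : linOrd.
Implicit Types x y z : L.

Lemma lin_lexx x : lin_le x x.
Proof. by case: (le_code_total_order (lin_LO L)) => -[[r _] _] _; apply: r. Qed.

Lemma lin_le_trans y x z : lin_le x y -> lin_le y z -> lin_le x z.
Proof.
by case: (le_code_total_order (lin_LO L)) => -[[_ t] _] _; apply: t.
Qed.

Lemma lin_le_anti x y : lin_le x y -> lin_le y x -> x = y.
Proof.
case: (le_code_total_order (lin_LO L)) => -[_ a] _ xy yx.
by apply: a; apply/andP; split.
Qed.

Lemma lin_le_total x y : lin_le x y \/ lin_le y x.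
Proof. by case: (le_code_total_order (lin_LO L)) => _ /(_ x y)/orP. Qed.

Lemma lin_ltNle x y : lin_lt x y <-> ~ lin_le y x.
Proof.
split=> [[xy ne] yx|nyx]; first exact/ne/lin_le_anti.
by split=> [|xy]; [case: (lin_le_total x y) | apply: nyx; rewrite xy lin_lexx].
Qed.

Lemma lin_le_or_lt x y : lin_le x y \/ lin_lt y x.
Proof.
by case: (boolP (lin_le x y)) => [|/negP]; [left | rewrite -lin_ltNle; right].
Qed.

Lemma lin_le_eqVlt x y : lin_le x y -> x = y \/ lin_lt x y.
Proof. by move=> xy; case: (EM (x = y)); [left | right]. Qed.

Lemma lin_le_lt_trans y x z : lin_le x y -> lin_lt y z -> lin_lt x z.
Proof. by rewrite !lin_ltNle => xy zy zx; apply/zy/(lin_le_trans zx). Qed.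

Lemma lin_ltxx x : ~ lin_lt x x.
Proof. by case. Qed.

End LinearOrder.

(** Nondecreasing maps. *)
Definition monotone (L K : linOrd) (p : L -> K) :=
  forall x y, lin_le x y -> lin_le (p x) (p y).

Section Embedding.
Variables (L L' : linOrd) (f : L -> L').

Lemma strict_mono_embedding :
  (forall x y, lin_lt x y -> lin_lt (f x) (f y)) -> embedding f.
Proof.
move=> fmono x y; apply/idP/idP => [|fxy].
  by move=> /lin_le_eqVlt[->|/fmono[]//]; rewrite lin_lexx.
by case: (lin_le_or_lt x y) => // /fmono/lin_ltNle.
Qed.

Lemma embedding_lt :
  embedding f -> forall x y, lin_lt x y <-> lin_lt (f x) (f y).
Proof. by move=> fe x y; rewrite !lin_ltNle fe. Qed.

End Embedding.

Lemma embedding_comp (L L' L'' : linOrd) (g : L' -> L'') (f : L -> L') :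
  embedding g -> embedding f -> embedding (g \o f).
Proof. by move=> ge fe x y; rewrite fe ge. Qed.

Section PullbackOrder.
Variables (T : Type) (M : linOrd) (f : T -> M).
Hypotheses (f_inj : injective f) (T_inh : inhabited T).

Lemma pullback_total_order : total_order (fun x y => lin_le (f x) (f y)).
Proof.
split; first split; first split=> [x|y x z]; first exact: lin_lexx.
- exact: lin_le_trans.
- by move=> x y /andP[xy yx]; apply: f_inj; apply: lin_le_anti.
- by move=> x y; apply/orP/lin_le_total.
Qed.

(** The order of [M] pulled back along an injection: it serves both as a
    suborder of [M] and as a copy of [M] on another carrier. *)
Definition pullback_LO : LO T := MkLO pullback_total_order T_inh.

End PullbackOrder.

Section OrdinalSum.
Variables X Y : linOrd.

Definition osum_le : rel (X + Y) := fun u v =>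
  match u, v with
  | inl x, inl x' => lin_le x x'
  | inl _, inr _ => true
  | inr _, inl _ => false
  | inr y, inr y' => lin_le y y'
  end.

Lemma osum_total_order : total_order osum_le.
Proof.
split; first split; first split.
- by case=> x; apply: lin_lexx.
- by case=> y [] x [] z //=; apply: lin_le_trans.
- by case=> x [] y //= /andP[xy yx]; congr (_ _); apply: lin_le_anti.
- by case=> x [] y //=; apply/orP/lin_le_total.
Qed.

Lemma osum_inhabited : inhabited (X + Y).
Proof. by case: (le_code_inhabited (lin_LO X)) => x; apply/inhabits/inl. Qed.

(** The ordinal sum [X + Y]: a copy of [X] followed by a copy of [Y]. *)
Definition osum : linOrd := LinOrd (MkLO osum_total_order osum_inhabited).

End OrdinalSum.

Section ConvexSumOrder.
Variables (K K' : linOrd) (F : K -> set K') (F_neq0 : forall k, F k !=set0).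
Implicit Types u v : csum F_neq0.

(** The component in the index order [K], and then the one in [K']. *)
Definition cidx u : K := (sval u).2.
Definition cval u : K' := (sval u).1.

Definition cpair k x (Fkx : F k x) : csum F_neq0 := exist _ (x, k) Fkx.

Lemma cvalP u : F (cidx u) (cval u).
Proof. by case: u. Qed.

Lemma csum_eq u v : cidx u = cidx v -> cval u = cval v -> u = v.
Proof.
case: u v => [[x k] h] [[x' k'] h']; rewrite /cidx /cval /= => ek ex.
by subst; congr exist; apply: Prop_irrelevance.
Qed.

Lemma csum_leP u v :
  lin_le u v <->
  lin_lt (cidx u) (cidx v) \/ cidx u = cidx v /\ lin_le (cval u) (cval v).
Proof.
have -> : lin_le u v = lin_le (cidx u) (cidx v) &&
  (lin_le (cidx v) (cidx u) ==> lin_le (cval u) (cval v)) by [].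
split=> [/andP[le /implyP h]|[lt|[-> le]]].
- case: (lin_le_eqVlt le) => [e|]; last by left.
  by right; split=> //; apply: h; rewrite e lin_lexx.
- case: (lt) => -> _ /=; apply/implyP => le.
  by move/lin_ltNle: lt.
- by rewrite lin_lexx le implybT.
Qed.

Lemma csum_ltP u v :
  lin_lt u v <->
  lin_lt (cidx u) (cidx v) \/ cidx u = cidx v /\ lin_lt (cval u) (cval v).
Proof.
rewrite /lin_lt csum_leP; split=> [[[lt|[e le]] ne]|[lt|[e [le ne]]]].
- by left.
- by right; split=> //; split=> // e'; apply/ne/csum_eq.
- by split=> [|e]; [left | case: lt => _; rewrite e].
- by split=> [|e']; [right | apply: ne; rewrite e'].
Qed.

Lemma cidx_mono : monotone cidx.
Proof. by move=> u v /csum_leP[[]|[-> _]] //; apply: lin_lexx. Qed.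

End ConvexSumOrder.

(** * Witnesses of convex embeddability *)

(** A partition of [L] into convex pieces indexed by [K] is the same thing as the
    map [p] sending each point to the index of its piece; [f] maps each piece
    onto a convex set iff no point between two images of a piece is missed.
    Indices of empty pieces are allowed here. *)
Definition cvx_witness (K L L' : linOrd) (p : L -> K) (f : L -> L') : Prop :=
  [/\ monotone p, embedding f &
      forall x y z, p x = p y -> lin_le (f x) z -> lin_le z (f y) ->
        exists w, f w = z].

Lemma witness_of_cvx_embeds (calL : linOrd -> Prop) (L L' : linOrd) :
  cvx_embeds calL L L' ->
  exists K : linOrd, calL K /\ exists (p : L -> K) (f : L -> L'),
    cvx_witness p f /\ forall k, exists x, p x = k.
Proof.
move=> [K [LK [P [[[covP trivP neP] ltP] [f [fe fcvx]]]]]].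
have inP x : exists k, P k x.
  have : cover [set: K] P x by rewrite covP.
  by case=> k _ ?; exists k.
have [p pP] := choice inP.
have pE k x : P k x -> p x = k.
  by move=> Pkx; apply: trivP => //; exists x.
exists K; split=> //; exists p, f; split=> [|k]; last first.
  by have [x /pE] := neP k I; exists x.
split=> // [x y xy|x y z exy fxz zfy].
- case: (lin_le_or_lt (p x) (p y)) => // /ltP/(_ y x (pP y) (pP x)).
  by rewrite lin_ltNle.
- have [||w _ <-] := fcvx (p x) (f x) z (f y) fxz zfy; last by exists w.
  + by exists x.
  + by exists y => //; rewrite exy.
Qed.

Lemma cvx_embeds_of_witness (kappa : cardinal) (calL : linOrd -> Prop)
    (K L L' : linOrd) (p : L -> K) (f : L -> L')
    (calLin : forall M, calL M -> Lin kappa M)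
    (calD : downward_closed kappa calL) :
  calL K -> cvx_witness p f -> cvx_embeds calL L L'.
Proof.
move=> LK [pm fe fc].
pose T := {k : K | exists x, p x = k}.
have inhT : inhabited T.
  case: (le_code_inhabited (lin_LO L)) => x.
  by apply: inhabits; exists (p x), x.
have sval_injT : injective (sval : T -> K).
  by move=> u v; apply: eq_sig_hprop => *; apply: Prop_irrelevance.
(* The indices of empty pieces are dropped, so that the pieces form a
   partition. *)
pose K0 := lin_of (pullback_LO sval_injT inhT).
have K0K : embeds K0 K by exists sval.
have LK0 : calL K0.
  apply: (calD _ _ _ K0K LK); apply: card_le_trans (calLin _ LK).
  by apply/card_leTP; exists sval.
pose q x : K0 := exist _ (p x) (ex_intro _ x erefl).
have qm : monotone q by move=> x y /pm.
have qE x y : q x = q y -> p x = p y by move=> /(congr1 sval).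
exists K0; split=> //; exists (fun k => [set x | q x = k]); split; last first.
  exists f; split=> // k a z b fxz zfy [x qx fx] [y qy fy]; subst a b.
  have exy : p x = p y by apply: qE; rewrite qx qy.
  have [w fw] := fc x y z exy fxz zfy; exists w => //=.
  move: fxz zfy; rewrite -fw -!fe => xw wy.
  by apply: (@lin_le_anti K0); [rewrite -qy | rewrite -qx]; apply: qm.
have q_surj k : exists x, q x = k.
  case: k => k [x px]; exists x.
  by apply: eq_sig_hprop => // *; apply: Prop_irrelevance.
split; first split.
- by apply/seteqP; split=> // x _; exists (q x).
- by move=> k k' _ _ [x [/= <- <-]].
- by move=> k _; have [x qx] := q_surj k; exists x.
move=> k k'; split=> [lt x y /= qx qy|lt].
  have /lin_ltNle nle : lin_lt (q x) (q y) by rewrite qx qy.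
  by apply/lin_ltNle => yx; apply/nle/qm.
have [x qx] := q_surj k; have [y qy] := q_surj k'.
have [xy ne] := lt x y qx qy; rewrite -qx -qy.
split=> [|e]; first exact: qm.
by apply: (@lin_ltxx _ x); apply: lt => //; rewrite /= -qy.
Qed.

(** * Transitivity from closure under convex sums *)

(** Composing two convex embeddings refines the pieces of the first one by the
    pieces of the second one met by their images; the refined pieces are indexed
    by a convex sum. *)
Lemma cvx_embeds_trans (kappa : cardinal) (calL : linOrd -> Prop)
    (calLin : forall M, calL M -> Lin kappa M)
    (calD : downward_closed kappa calL) :
  ccs calL -> Transitive (cvx_embeds calL).
Proof.
move=> calC L L' L''.
move=> /witness_of_cvx_embeds[K [LK [p [f [[pm fe fc] p_surj]]]]].
move=> /witness_of_cvx_embeds[K' [LK' [q [g [[qm ge gc] q_surj]]]]].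
pose F k : set K' := [set k' | exists2 x, p x = k & q (f x) = k'].
have F_neq0 k : F k !=set0 by have [x px] := p_surj k; exists (q (f x)), x.
have F_cvx k : convex (F k).
  move=> a k' b le1 le2 [x1 px1 qx1] [x2 px2 qx2]; subst a b.
  case: (lin_le_eqVlt le1) => [<-|lt1]; first by exists x1.
  case: (lin_le_eqVlt le2) => [->|lt2]; first by exists x2.
  have [y qy] := q_surj k'; subst k'.
  have f1y : lin_le (f x1) y.
    by case: (lin_le_or_lt (f x1) y) => // -[/qm le _]; case/lin_ltNle: lt1.
  have yf2 : lin_le y (f x2).
    by case: (lin_le_or_lt y (f x2)) => // -[/qm le _]; case/lin_ltNle: lt2.
  have [|w fw] := fc x1 x2 y _ f1y yf2; first by rewrite px1 px2.
  exists w; last by rewrite fw.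
  move: f1y yf2; rewrite -fw -!fe => /pm w1 /pm w2.
  by apply: lin_le_anti; [rewrite -px2 | rewrite -px1].
have F_mono k0 k1 : lin_lt k0 k1 -> set_le (F k0) (F k1).
  move=> lt a b [x0 px0 qx0] [x1 px1 qx1]; subst a b; apply: qm; rewrite -fe.
  case: (lin_le_or_lt x0 x1) => // -[/pm].
  by rewrite px0 px1 => le _; case/lin_ltNle: lt.
have LC := calC K K' LK LK' F F_neq0 F_cvx F_mono.
pose r x : csum F_neq0 := cpair F_neq0 (ex_intro2 _ _ x erefl erefl).
apply: (cvx_embeds_of_witness calLin calD LC (p := r) (f := g \o f)).
split=> [x y xy||x y z exy gx gy].
- apply/csum_leP => /=; case: (lin_le_eqVlt (pm _ _ xy)) => [e|]; last by left.
  by right; split=> //; apply: qm; rewrite -fe.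
- exact: embedding_comp.
- have epxy : p x = p y by apply: (congr1 (@cidx _ _ _ _) exy).
  have eqxy : q (f x) = q (f y) by apply: (congr1 (@cval _ _ _ _) exy).
  have [v gv] := gc _ _ _ eqxy gx gy; move: gx gy; rewrite /= -gv -!ge => xv vy.
  by have [w fw] := fc _ _ _ epxy xv vy; exists w; rewrite /= fw.
Qed.

(** * Relabelling *)

Lemma cvx_witness_iso (K L L' M M' : linOrd) (p : L -> K) (f : L -> L')
    (u : M -> L) (g : L' -> M') :
  embedding u -> (forall x, exists m, u m = x) ->
  embedding g -> (forall m, exists x, g x = m) ->
  cvx_witness p f -> cvx_witness (p \o u) (g \o f \o u).
Proof.
move=> ue u_surj ge g_surj [pm fe fc]; split.
- by move=> x y xy; apply: pm; rewrite -ue.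
- by do 2! apply: embedding_comp => //.
- move=> x y z exy; have [z' <-] := g_surj z.
  rewrite /= -!ge => le1 le2; have [w <-] := fc _ _ _ exy le1 le2.
  by have [m <-] := u_surj w; exists m.
Qed.

(** A linear order equipotent to [T] has a copy with domain [T]. *)
Lemma exists_code (T : Type) (M : linOrd) :
  [set: M] #<= [set: T] -> [set: T] #<= [set: M] ->
  exists (r : LO T) (u : lin_of r -> M) (v : M -> lin_of r),
    [/\ embedding u, embedding v, cancel u v & cancel v u].
Proof.
move=> MT TM; have : [set: T] #= [set: M] by rewrite card_eq_le TM MT.
case/card_bijP=> f [g fK gK].
pose u (t : T) : M := val (f (to_setT t)).
pose v (x : M) : T := val (g (to_setT x)).
have uK : cancel u v.
  move=> t; rewrite /v (_ : to_setT _ = f (to_setT t)) ?fK //.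
  exact: val_inj.
have vK : cancel v u.
  move=> x; rewrite /u (_ : to_setT _ = g (to_setT x)) ?gK //.
  exact: val_inj.
have T_inh : inhabited T.
  by have [x] := le_code_inhabited (lin_LO M); apply: inhabits (v x).
exists (pullback_LO (can_inj uK) T_inh), u, v; split=> // x y.
by rewrite -{1}(vK x) -{1}(vK y).
Qed.

(** * Blowing up the points of a linear order *)

(** Orders without extrema in which every final segment with a least element is
    a well-order. Every point then has an immediate successor, while no initial
    segment embeds with an image bounded below, since it has no least point. For
    instance, [omega^* + kappa] is such an order. *)
Record blowup_order (A : linOrd) : Prop := BlowupOrder {
  blowup_min : forall (S : set A) b,
    S !=set0 -> (forall x, S x -> lin_le b x) ->
    exists2 m, S m & forall x, S x -> lin_le m x;
  blowup_nomax : forall x : A, exists y, lin_lt x y;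
  blowup_nomin : forall x : A, exists y, lin_lt y x }.

Lemma unit_total_order : total_order (fun _ _ : unit => true).
Proof. by split; first split; first split=> //; move=> [] []. Qed.

Definition one_point : linOrd := LinOrd (MkLO unit_total_order (inhabits tt)).

Section Blowup.
Variables (A C : linOrd).
Hypothesis HA : blowup_order A.

(** One extra point, kept only if [gap] holds, followed by [A]. *)
Definition block (gap : Prop) : set (osum one_point A) :=
  [set b | match b with inl _ => gap | inr _ => True end].

Lemma block_neq0 (G : C -> Prop) c : block (G c) !=set0.
Proof. by have [a] := le_code_inhabited (lin_LO A); exists (inr a). Qed.

(** Every point of [C] is replaced by a copy of [A], and a further point, its
    gap, is put before this copy at those points of [C] that satisfy [G]. *)
Definition blowup (G : C -> Prop) : linOrd := csum (block_neq0 G).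

(** The point [a] of the copy of [A] at [c]. *)
Definition bpoint G (c : C) (a : A) : blowup G :=
  cpair (block_neq0 G) (I : block (G c) (inr a)).

(** The gap at [c]. *)
Definition bgap G (c : C) (Gc : G c) : blowup G :=
  cpair (block_neq0 G) (Gc : block (G c) (inl tt)).

Variant blowup_spec G : blowup G -> Type :=
  | BPoint c a : blowup_spec (bpoint G c a)
  | BGap c (Gc : G c) : blowup_spec (bgap Gc).

Lemma blowupP G (x : blowup G) : blowup_spec x.
Proof.
case: x => [[[[]|a] c] /= h]; first exact: BGap.
by case: h; apply: BPoint.
Qed.

Section Inclusion.
Variables G G' : C -> Prop.
Hypothesis GG' : forall c, G c -> G' c.

Lemma block_sub (x : blowup G) : block (G' (cidx x)) (cval x).
Proof. by have := cvalP x; rewrite /block /=; case: (cval x) => //= _ /GG'. Qed.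

Definition blowup_incl (x : blowup G) : blowup G' :=
  cpair (block_neq0 G') (block_sub x).

Lemma blowup_incl_embedding : embedding blowup_incl.
Proof. by []. Qed.

Lemma bpoint_incl c a : blowup_incl (bpoint G c a) = bpoint G' c a.
Proof. exact: csum_eq. Qed.

End Inclusion.

Definition no_gaps : C -> Prop := fun _ => False.
Definition all_gaps : C -> Prop := fun _ => True.
Definition gap (c : C) : blowup all_gaps := @bgap all_gaps c I.

Lemma blowup_succ (x : blowup no_gaps) :
  exists2 y, lin_lt x y & forall z, lin_lt x z -> lin_le y z.
Proof.
case: (blowupP x) => {x} [c a|c []].
have [||a' aa' mina'] := blowup_min HA (S := [set b | lin_lt a b]) (b := a).
- exact: blowup_nomax HA a.
- by move=> b [].
exists (bpoint _ c a').
  apply/csum_ltP; right; split=> //.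
  by apply/lin_ltNle => le; case/lin_ltNle: aa'.
move=> z; case: (blowupP z) => [d b|d []] /csum_ltP[lt|[/= e lt]].
  by apply/csum_leP; left.
apply/csum_leP; right; split=> //=; apply: mina'.
by move/lin_ltNle: lt => nle; apply/lin_ltNle.
Qed.

Lemma bgap_no_succ (c : C) (z : blowup all_gaps) :
  lin_lt (gap c) z ->
  exists2 y, lin_lt (gap c) y & lin_lt y z.
Proof.
case/csum_ltP => [lt|[/=]].
  have [a] := le_code_inhabited (lin_LO A).
  by (exists (bpoint _ c a); apply/csum_ltP); [right; split=> //; split | left].
case: (blowupP z) => [d a|d Gd] e lt; last by case: lt.
have {}e : c = d := e; subst d.
have [a' a'a] := blowup_nomin HA a.
(exists (bpoint _ c a'); apply/csum_ltP; right); split=> //.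
by apply/lin_ltNle => le; case/lin_ltNle: a'a.
Qed.

(** In a convex embedding of the gapless blow-up of [C] into the blow-up with all
    gaps, no piece meets two copies of [A]. Otherwise the convex image of that
    piece contains a gap [h w] below another of its points, and [h w] inherits
    from [w] an immediate successor, which gaps do not have. *)
Lemma blowup_separated (K : linOrd) (p : blowup no_gaps -> K)
    (h : blowup no_gaps -> blowup all_gaps) (a0 : A) (c d : C) :
  cvx_witness p h -> lin_lt c d ->
  lin_lt (p (bpoint _ c a0)) (p (bpoint _ d a0)).
Proof.
move=> [pm he hc] cd; have hlt := embedding_lt he.
set x := bpoint _ c a0; set y := bpoint _ d a0.
have xy : lin_lt x y by apply/csum_ltP; left.
split=> [|exy]; first exact/pm/(proj1 xy).
have [a1 a10] := blowup_nomin HA a0.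
pose t b : blowup no_gaps := bpoint _ d b.
have xt b : lin_lt x (t b) by apply/csum_ltP; left.
have tlt b b' : lin_lt b b' -> lin_lt (t b) (t b').
  move=> bb'; apply/csum_ltP; right; split=> //.
  by apply/lin_ltNle => le; case/lin_ltNle: bb'.
have [e [xg gy]] : exists e, lin_le (h x) (gap e) /\ lin_lt (gap e) (h y).
  have hty : lin_lt (h (t a1)) (h y) by apply/hlt/tlt.
  have le1 : lin_le (h x) (h (t a1)) by rewrite -he; case: (xt a1).
  have bot z : lin_le (gap (cidx z)) z.
    by apply/csum_leP; right; split=> //; case: (blowupP z).
  case: (lin_le_eqVlt (cidx_mono le1)) => [ee|lt]; last first.
    exists (cidx (h (t a1))); split; last exact: lin_le_lt_trans (bot _) hty.
    by apply/csum_leP; left.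
  have [[f hx]|[f [u hx]]] : (exists f, h x = gap f) \/
      exists f u, h x = bpoint _ f u.
    case: (blowupP (h x)) => [f u|f []]; last by left; exists f.
    by right; exists f, u.
    by exists f; rewrite -hx lin_lexx; split=> //; apply/hlt.
  have {}ee : f = cidx (h (t a1)) by rewrite -ee hx.
  (* Now [h x] and [h (t a1)] lie in the same copy of [A]. The points of the copy
     of [A] at [d] up to [a1] are mapped between them, so their images have a
     minimum, although they have none themselves. *)
  exfalso.
  have ht b : lin_le b a1 -> exists2 b', lin_le u b' & h (t b) = bpoint _ f b'.
    move=> ba.
    have l1 : lin_le (bpoint all_gaps f u) (h (t b)).
      by rewrite -hx -he; case: (xt b).
    have l2 : lin_le (h (t b)) (h (t a1)).
      rewrite -he; case: (lin_le_eqVlt ba) => [->|/tlt[]//]; exact: lin_lexx.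
    have ef : f = cidx (h (t b)).
      apply: lin_le_anti; first exact: cidx_mono l1.
      by rewrite ee; exact: cidx_mono l2.
    move: l1 ef; case: (blowupP (h (t b))) => [f' b'|f' []] /csum_leP l1 ef;
      have {}ef : f = f' := ef; subst f'.
      by exists b' => //; case: l1 => [/lin_ltxx|[]].
    by case: l1 => [/lin_ltxx|[]].
  have [|z [b ba htb]|m [b ba htb] minm] := blowup_min HA (b := u)
      (S := [set z | exists2 b, lin_le b a1 & h (t b) = bpoint _ f z]).
  - have [b' _ hb'] := ht a1 (lin_lexx _).
    by exists b', a1 => //; exact: lin_lexx.
  - by have [b' ub'] := ht b ba; rewrite htb => -[->].
  have [b' b'b] := blowup_nomin HA b.
  have b'a : lin_le b' a1 := lin_le_trans (proj1 b'b) ba.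
  have [m' um' hm'] := ht b' b'a.
  have /hlt := tlt _ _ b'b; rewrite htb hm' => /csum_ltP[/lin_ltxx//|[_ m'm]].
  by case/lin_ltNle: m'm; apply: minm; exists b'.
have [w hw] := hc _ _ _ exy xg (proj1 gy).
have [w' ww' minw'] := blowup_succ w.
have wy : lin_lt w y by apply/hlt; rewrite hw.
have := ww'; rewrite hlt hw => /bgap_no_succ[z gz zw'].
have w'y : lin_le (h w') (h y) by rewrite -he; apply: minw'.
have [||v hv] := hc _ _ z exy.
- exact: lin_le_trans xg (proj1 gz).
- exact: lin_le_trans (proj1 zw') w'y.
have wv : lin_lt w v by apply/hlt; rewrite hv hw.
by move: zw'; rewrite -hv -hlt => /lin_ltNle; apply; apply: minw'.
Qed.

End Blowup.

(** * The order omega^* + kappa *)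

Lemma well_order_min (T : Type) (r : rel T) (S : set T) :
  well_order r -> S !=set0 -> exists2 m, S m & forall x, S x -> r m x.
Proof.
move=> wo [x Sx]; have [|m [[Sm lem] _]] := wo [pred x | `[< S x >]].
  by exists x; apply/asboolP.
by exists m => [|y Sy]; [apply/asboolP | apply/lem/asboolP].
Qed.

Lemma well_order_total_order (T : Type) (r : rel T) :
  well_order r -> total_order r.
Proof.
move=> wo.
have rtot : total r.
  move=> x y; have [|m Sm le] := well_order_min (S := [set x; y]) wo.
    by exists x; left.
  case: Sm le => -> le; first by rewrite le //; right.
  by rewrite (le x) ?orbT //; left.
have ranti : antisymmetric r.
  move=> x y /andP[xy yx].
  have [|m [_ uniqm]] := wo [pred z | `[< z = x \/ z = y >]].
    by exists x; apply/asboolP; left.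
  have rxx : r x x by case/orP: (rtot x x).
  have ryy : r y y by case/orP: (rtot y y).
  rewrite -(uniqm x); last first.
    by split=> [|z /asboolP[]->//]; apply/asboolP; left.
  by apply: uniqm; split=> [|z /asboolP[]->//]; apply/asboolP; right.
split=> //; split=> //; split=> [x|y x z xy yz]; first by case/orP: (rtot x x).
have [|m mS le] := well_order_min (S := [set t | [\/ t = x, t = y | t = z]]) wo.
  by exists x; constructor 1.
case: mS le => -> le.
- by apply: le; constructor 3.
- have yx : r y x by apply: le; constructor 1.
  by rewrite (ranti x y) // xy yx.
- have zy : r z y by apply: le; constructor 2.
  by rewrite (ranti z y) // zy yz.
Qed.

Lemma nat_op_total_order : total_order (fun m n : nat => n <= m).
Proof.
split; first split; first split=> // [y x z xy yz].
- exact: leq_trans yz xy.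
- by move=> x y; rewrite andbC => /anti_leq.
- by move=> x y; apply: leq_total.
Qed.

(** The order type [omega^*] of the negative integers. *)
Definition omega_op : linOrd := LinOrd (MkLO nat_op_total_order (inhabits 0)).

Section OmegaOpPlusKappa.
Variable kappa : cardinal.
Hypothesis kappa_infinite : infinite_cardinal kappa.

Lemma nat_inj_cardinal : exists f : nat -> kappa, injective f.
Proof. by apply/card_leTP/infiniteP. Qed.

(** The cardinal [kappa] as a well-ordered linear order. *)
Definition kappa_order : linOrd :=
  LinOrd (MkLO (well_order_total_order (@ord_le_wo kappa))
    (let: ex_intro f _ := nat_inj_cardinal in inhabits (f 0))).

Lemma two_below :
  exists p q a : kappa_order, [/\ p <> q, lin_lt p a & lin_lt q a].
Proof.
have [f fi] := nat_inj_cardinal; pose g : nat -> kappa_order := f.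
have ne m n : m <> n -> g m <> g n by move=> mn /fi.
have lt m n : m <> n -> lin_le (g m) (g n) -> lin_lt (g m) (g n).
  by move=> mn le; split=> //; apply: ne.
case: (lin_le_total (g 0) (g 1)) => le01.
- case: (lin_le_total (g 1) (g 2)) => le12.
  + exists (g 0), (g 1), (g 2); split; [exact: ne| |exact: lt].
    by apply: lt => //; apply: lin_le_trans le12.
  + by exists (g 0), (g 2), (g 1); split; [exact: ne|exact: lt|exact: lt].
- case: (lin_le_total (g 0) (g 2)) => le02.
  + exists (g 0), (g 1), (g 2); split; [exact: ne|exact: lt|].
    by apply: lt => //; apply: lin_le_trans le02.
  + by exists (g 1), (g 2), (g 0); split; [exact: ne|exact: lt|exact: lt].
Qed.

(** Sequences of a fixed length at least two already number [kappa * kappa]. *)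
Lemma square_inj_cardinal : pow_lt_self kappa ->
  exists f : kappa * kappa -> kappa, injective f.
Proof.
move=> kpow; apply/card_leTP.
apply: (@card_le_trans _ _ _ [set: lt_sequences kappa]); last first.
  by have := kpow; rewrite /pow_lt_self card_eq_le => /andP[].
apply/card_leTP; have [p [q [a [pq pa qa]]]] := two_below.
pose d (s : lt_sequences kappa) (c : kappa) : option kappa :=
  if pselect (initseg (@ord_le kappa) (projT1 s) c) is left H
  then Some (projT2 s (exist _ c H)) else None.
pose e (x : kappa * kappa) : lt_sequences kappa :=
  existT _ a (fun b => if `[< sval b = p >] then x.1 else x.2).
exists e => x y exy.
have := congr1 (d^~ p) exy; have := congr1 (d^~ q) exy; rewrite /d /=.
case: pselect => // _; case: pselect => // _.
rewrite !(asboolT (erefl p)) !(asboolF (nesym pq)) => -[e2] [e1].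
by rewrite [x]surjective_pairing [y]surjective_pairing e1 e2.
Qed.

Hypothesis kappa_square : exists f : kappa * kappa -> kappa, injective f.

(** Infinite initial ordinals are limits. *)
Lemma kappa_nomax (x : kappa_order) : exists y, lin_lt x y.
Proof.
apply: contrapT => /forallNP xmax.
have {}xmax y : lin_le y x by case: (lin_le_or_lt y x) => // /xmax.
have [p [q [_ [pq _ _]]]] := two_below.
have [f fi] := kappa_square.
(* One of the rows [f (p, _)] and [f (q, _)] avoids [x], and injects [kappa]
   into the initial segment below [x]. *)
have [r rx] : exists r, forall t, f (r, t) <> x.
  case: (EM (exists t, f (p, t) = x)) => [[t <-]|nex]; last first.
    by exists p => t e; apply: nex; exists t.
  by exists q => t' /fi [] /esym.
have /negP := card_initial x; apply.
have frow : {in [set: kappa] &, injective (fun t => f (r, t))}.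
  by move=> s t _ _ /fi[].
have := inj_card_eq frow; rewrite card_eq_le => /andP[_ /card_le_trans]; apply.
apply: subset_card_le => _ [t _ <-].
by split; [exact: xmax | exact: rx].
Qed.

Definition omega_op_kappa : linOrd := osum omega_op kappa_order.

Lemma omega_op_kappa_blowup : blowup_order omega_op_kappa.
Proof.
split=> [S b [s Ss] bS|[n|x]|[n|x]].
- have [[n Sn]|noS] := EM (exists n : nat, S (inl n)); last first.
    have [|m Sm le] :=
      well_order_min (S := [set x | S (inr x)]) (@ord_le_wo kappa).
      by case: s Ss => [n Sn|x Sx]; [case: noS; exists n | exists x].
    exists (inr m) => // -[n Sn|x Sx]; first by case: noS; exists n.
    exact: le.
  have exn : exists n, `[< S (inl n) >] by exists n; apply/asboolP.
  have [k bk] : exists k, b = inl k.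
    by case: b bS => [k|x] bS; [exists k | have := bS _ Sn].
  have ubn m : `[< S (inl m) >] -> m <= k by move=> /asboolP/bS; rewrite bk.
  case: (ex_maxnP exn ubn) => m /asboolP Sm le.
  exists (inl m) => // -[m' Sm'|//].
  by apply: le; apply/asboolP.
- have [x] := le_code_inhabited (lin_LO kappa_order).
  by exists (inr x).
- have [y xy] := kappa_nomax x; exists (inr y).
  by apply/lin_ltNle => yx; case/lin_ltNle: xy.
- by exists (inl n.+1); split=> [|[/esym/n_Sn]] //; exact: leqnSn.
- by exists (inl 0).
Qed.

End OmegaOpPlusKappa.

(** * Closure under convex sums from transitivity *)

Section Converse.
Variables (kappa : cardinal) (calL : linOrd -> Prop).
Hypotheses (kappa_infinite : infinite_cardinal kappa)
  (kappa_square : exists f : kappa * kappa -> kappa, injective f)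
  (calLin : forall L, calL L -> Lin kappa L)
  (calD : downward_closed kappa calL).

Let A := omega_op_kappa kappa_infinite.
Let HA : blowup_order A := omega_op_kappa_blowup kappa_infinite kappa_square.

Lemma prod_inj_cardinal (T U : Type) :
  [set: T] #<= [set: kappa] -> [set: U] #<= [set: kappa] ->
  [set: T * U] #<= [set: kappa].
Proof.
have [f fi] := kappa_square.
move=> /card_leTP[g gi] /card_leTP[h hi]; apply/card_leTP.
by exists (fun x => f (g x.1, h x.2)) => -[x y] [x' y'] /fi[/gi-> /hi->].
Qed.

Lemma sum_inj_cardinal (T U : Type) :
  [set: T] #<= [set: kappa] -> [set: U] #<= [set: kappa] ->
  [set: T + U] #<= [set: kappa].
Proof.
have [f fi] := kappa_square.
have [p [q [_ [pq _ _]]]] := two_below kappa_infinite.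
move=> /card_leTP[g gi] /card_leTP[h hi]; apply/card_leTP.
exists (fun x => match x with inl t => f (p, g t) | inr u => f (q, h u) end).
by move=> [x|x] [y|y] /fi [] => [/gi->|/pq|/esym/pq|/hi->].
Qed.

Lemma csum_card (K K' : linOrd) (F : K -> set K')
    (F_neq0 : forall k, F k !=set0) :
  Lin kappa K -> Lin kappa K' -> Lin kappa (csum F_neq0).
Proof.
move=> KK KK'; apply: card_le_trans (prod_inj_cardinal KK' KK).
apply/card_leTP; exists sval => u v.
by apply: eq_sig_hprop => *; apply: Prop_irrelevance.
Qed.

(** Blow-ups of orders of size at most [kappa] have size exactly [kappa]. *)
Lemma blowup_code (C : linOrd) (G : C -> Prop) : Lin kappa C ->
  exists (r : LO kappa)
    (u : lin_of r -> blowup A G) (v : blowup A G -> lin_of r),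
    [/\ embedding u, embedding v, cancel u v & cancel v u].
Proof.
move=> CK; apply: exists_code.
  apply: csum_card => //; apply: sum_inj_cardinal.
    have [f _] := nat_inj_cardinal kappa_infinite.
    by apply/card_leTP; exists (fun=> f 0) => -[] [].
  by apply: sum_inj_cardinal (card_lexx _); apply/infiniteP.
have [c] := le_code_inhabited (lin_LO C).
by apply/card_leTP; exists (fun x => bpoint G c (inr x : A)) => x y [].
Qed.

(** Three blow-ups of the convex sum [C] are compared: without gaps, with gaps at
    the first point over each [k], and with all gaps. The partition according to
    [k] takes the first to the second, the one according to [k'] takes the second
    to the third, and the index order of any direct partition from the first to
    the third contains a copy of [C]. *)
Lemma trans_ccs :
  Transitive (fun r r' : LO kappa => cvx_embeds calL (lin_of r) (lin_of r')) ->
  ccs calL.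
Proof.
move=> trans K K' LK LK' F F_neq0 F_cvx F_mono.
set C := csum F_neq0.
have CK : Lin kappa C by apply: csum_card; apply: calLin.
have Cval_mono : monotone (@cval _ _ _ F_neq0).
  move=> x y /csum_leP[lt|[]//]; exact: F_mono lt _ _ (cvalP x) (cvalP y).
pose G (c : C) := forall k', F (cidx c) k' -> lin_le (cval c) k'.
have [r0 [u0 [v0 [u0e v0e u0K v0K]]]] := blowup_code (@no_gaps C) CK.
have [r1 [u1 [v1 [u1e v1e u1K v1K]]]] := blowup_code G CK.
have [r2 [u2 [v2 [u2e v2e u2K v2K]]]] := blowup_code (@all_gaps C) CK.
have sub01 c : no_gaps c -> G c by [].
have sub12 c : G c -> all_gaps c by [].
have i01 : cvx_witness (fun x => cidx (cidx x)) (@blowup_incl A C _ _ sub01).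
  split=> [x y /cidx_mono/cidx_mono//||x y z exy xz zy].
    exact: blowup_incl_embedding.
  case: (blowupP z) xz zy => [c a|c Gc] xz zy.
    by exists (bpoint _ c a); exact: bpoint_incl.
  (* A gap at [c] cannot lie between two points over the same [k], since [c] is
     the first element over [k] in the convex sum. *)
  exfalso; have le1 := cidx_mono xz; have le2 := cidx_mono zy.
  have ek : cidx (cidx x) = cidx c.
    apply: lin_le_anti; first exact: cidx_mono le1.
    by rewrite exy; exact: cidx_mono le2.
  have ec : cidx x = c.
    apply: csum_eq => //; apply: lin_le_anti; last first.
      by apply: (Gc); rewrite -ek; exact: cvalP.
    by case/csum_leP: le1 => [[_ /(_ ek)]|[]].
  move: xz ec; case: (blowupP x) => [c1 a1|c1 []] /csum_leP xz ec.
  by case: xz => [[_ /(_ ec)]|[]].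
have i12 : cvx_witness (fun x => cval (cidx x)) (@blowup_incl A C _ _ sub12).
  split=> [x y /cidx_mono/Cval_mono//||x y z exy xz zy].
    exact: blowup_incl_embedding.
  case: (blowupP z) xz zy => [c a|c Gc] xz zy.
    by exists (bpoint _ c a); exact: bpoint_incl.
  (* The gap at [c] belongs to the middle blow-up as soon as some smaller point
     of that blow-up lies over the same [k']. *)
  have le1 := cidx_mono xz; have le2 := cidx_mono zy.
  have ek : cval (cidx x) = cval c.
    apply: lin_le_anti; first exact: Cval_mono le1.
    by rewrite exy; exact: Cval_mono le2.
  suff gc : G c by exists (bgap A gc); exact: csum_eq.
  case: (EM (cidx x = c)) => [ec|nec].
    move: xz ec; case: (blowupP x) => [c1 a1|c1 g1] /csum_leP xz ec; last first.
      by have <- : c1 = c := ec.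
    by case: xz => [[_ /(_ ec)]|[]].
  move=> k' Fk'; rewrite -ek.
  case/csum_leP: le1 => [lt|[e _]]; first exact: F_mono lt _ _ (cvalP _) Fk'.
  by case: nec; exact: csum_eq.
have e01 : cvx_embeds calL (lin_of r0) (lin_of r1).
  apply: (cvx_embeds_of_witness calLin calD LK).
  apply: cvx_witness_iso u0e _ v1e _ i01.
  - by move=> x; exists (v0 x).
  - by move=> m; exists (u1 m).
have e12 : cvx_embeds calL (lin_of r1) (lin_of r2).
  apply: (cvx_embeds_of_witness calLin calD LK').
  apply: cvx_witness_iso u1e _ v2e _ i12.
  - by move=> x; exists (v1 x).
  - by move=> m; exists (u2 m).
have [K2 [LK2 [p [f [wit _]]]]] := witness_of_cvx_embeds (trans _ _ _ e01 e12).
have wit2 : cvx_witness (p \o v0) (u2 \o f \o v0).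
  apply: cvx_witness_iso v0e _ u2e _ wit.
  - by move=> x; exists (u0 x).
  - by move=> m; exists (v2 m).
have [a0] := le_code_inhabited (lin_LO A).
apply: calD CK _ LK2.
exists (fun c => (p \o v0) (bpoint _ c a0)).
apply: strict_mono_embedding => c d; exact: (blowup_separated HA _ wit2).
Qed.

End Converse.

Theorem theorem8p16 (kappa : cardinal) (calL : linOrd -> Prop)
    (kappa_infinite : infinite_cardinal kappa)
    (kappa_pow : pow_lt_self kappa)
    (calL_Lin : forall L, calL L -> Lin kappa L)
    (calL_neq0 : exists L, calL L)
    (calL_down : downward_closed kappa calL) :
  [<-> ccs calL;
       Transitive (cvx_embeds calL);
       Transitive (fun L L' : {L : linOrd | Lin kappa L} =>
         cvx_embeds calL (sval L) (sval L'));
       Transitive (fun r r' : LO kappa =>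
         cvx_embeds calL (lin_of r) (lin_of r'))].
Proof.
tfae.
- exact: cvx_embeds_trans calL_Lin calL_down.
- by move=> trans L L' L''; apply: trans.
- move=> trans r r' r''.
  pose code (s : LO kappa) : {L | Lin kappa L} :=
    exist _ (lin_of s) (card_lexx _).
  exact: (trans (code r) (code r') (code r'')).
- exact: trans_ccs kappa_infinite (square_inj_cardinal kappa_infinite kappa_pow)
    calL_Lin calL_down.
Qed.
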